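(* Let $\varepsilon>0$. For every algorithm $\mathcal{A}_{2P}$ that is $\varepsilon$-pan-private against two intrusions and generates output distribution $O$ given input stream $s$, there exists a protocol $\mathcal{A}_L$ that is sequentially interactive and $\varepsilon$-locally differentially private and generates transcript distribution $O$ given $s$; and conversely, for every sequentially interactive $\varepsilon$-locally differentially private protocol $\mathcal{A}_L$ generating transcript distribution $O$ on input stream $s$, there exists an algorithm $\mathcal{A}_{2P}$ that is $\varepsilon$-pan-private against two intrusions and generates output distribution $O$ given $s$.
   Context: Let $\mathcal{X}$ be a data universe and let streams be sequences of elements of $\mathcal{X}$. Two streams $s,s'$ are neighbors if $s'$ is obtained from $s$ by replacing a single element $x$ of $s$ with some $x'\in\mathcal{X}$. A streaming algorithm $\mathcal{A}$ consists of an internal (randomized) update algorithm $\mathcal{A}_{\mathcal{I}}\colon \mathcal{I}\times\mathcal{X}\to\mathcal{I}$ (from a fixed initial state) and an output algorithm $\mathcal{A}_{\mathcal{O}}$ applied to the final internal state; write $\mathcal{A}_{\mathcal{I}}(s_{\le t})$ for the internal state after processing the first $t$ elements of $s$ and $\mathcal{A}_{\mathcal{O}}(\mathcal{A}_{\mathcal{I}}(s))$ for the output. $\mathcal{A}$ is $\varepsilon$-pan-private against $c$ intrusions if for all neighboring streams $s,s'$, all times $t_1,\dots,t_c$, and all measurable sets $E\subset \mathcal{I}^c\times\mathcal{O}$, $\Pr[(\mathcal{A}_{\mathcal{I}}(s_{\le t_1}),\dots,\mathcal{A}_{\mathcal{I}}(s_{\le t_c}),\mathcal{A}_{\mathcal{O}}(\mathcal{A}_{\mathcal{I}}(s)))\in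 E]\le e^{\varepsilon}\Pr[(\mathcal{A}_{\mathcal{I}}(s'_{\le t_1}),\dots,\mathcal{A}_{\mathcal{I}}(s'_{\le t_c}),\mathcal{A}_{\mathcal{O}}(\mathcal{A}_{\mathcal{I}}(s')))\in E]$ (here the joint distribution is over the algorithm's randomness in one run). An $\varepsilon$-randomizer is an $\varepsilon$-differentially private randomized function $R\colon\mathcal{X}\to Y$ of a single data point. In the local model each stream element $s_t$ is held by a user; a transcript is the vector of pairs $(R_t,y_t)$ of the randomizer assigned at time $t$ and its output $y_t=R_t(s_t)$. A protocol maps the transcript so far to the randomizer for the next element; it is sequentially interactive if it queries each element once, in order, choosing $R_t$ adaptively from the transcript of times $<t$. A protocol is $\varepsilon$-locally differentially private if its transcript is an $\varepsilon$-differentially private function of the stream (for sequentially interactive protocols, equivalently each $R_t$ is an $\varepsilon$-randomizer).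
   Formalization: From pan-private to local, O is the distribution of a fixed, data-independent deterministic function of the transcript, for nonempty streams; literal equality fails, since a transcript is a vector of pairs while outputs are arbitrary, and with no elements the transcript is deterministic. *)

(* Defs.v *)
From HB Require Import structures.
From mathcomp Require Import all_boot all_order all_algebra.
From mathcomp Require Import all_classical all_reals all_analysis.
From mathcomp Require Import measurable_realfun.

Set Implicit Arguments.
Unset Strict Implicit.
Unset Printing Implicit Defensive.

Import Order.TTheory GRing.Theory Num.Theory.

Local Open Scope classical_set_scope.
Local Open Scope ring_scope.
Local Open Scope ereal_scope.

Section kernel_operations.
Context d1 d2 d3 (T1 : measurableType d1) (T2 : measurableType d2)
  (T3 : measurableType d3) (R : realType).

Section kprecomp.
Variables (k : R.-pker T2 ~> T3) (g : {mfun T1 >-> T2}).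

Definition kprecomp : T1 -> {measure set T3 -> \bar R} := fun x => k (g x).

Let measurable_kprecomp U : measurable U ->
  measurable_fun [set: T1] (kprecomp ^~ U).
Proof. by move=> mU; exact: measurableT_comp (measurable_kernel k _ mU) _. Qed.

HB.instance Definition _ := isKernel.Build _ _ _ _ _ kprecomp
  measurable_kprecomp.

Let kprecomp_prob x : kprecomp x [set: T3] = 1.
Proof. exact: prob_kernel. Qed.

HB.instance Definition _ := Kernel_isProbability.Build _ _ _ _ _ kprecomp
  kprecomp_prob.

End kprecomp.

(* [kimage k f x] is the law of [f (x, y)] for [y] drawn from [k x]. *)
Section kimage.
Variables (k : R.-pker T1 ~> T2) (f : {mfun (T1 * T2)%type >-> T3}).

Definition kimage_subdef (x : T1) (A : set T3) : \bar R :=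
  k x [set y | A (f (x, y))].

Let measurable_fx x : measurable_fun [set: T2] (fun y => f (x, y)).
Proof. exact: measurableT_comp. Qed.

Let kimage0 x : kimage_subdef x set0 = 0.
Proof. exact: (measure0 (k x)). Qed.

Let kimage_ge0 x A : 0 <= kimage_subdef x A.
Proof. exact: measure_ge0. Qed.

Let kimage_sigma_additive x : semi_sigma_additive (kimage_subdef x).
Proof.
move=> F mF tF mUF; rewrite /kimage_subdef.
have mpre A : measurable A -> measurable [set y | A (f (x, y))].
  by move=> mA; rewrite -[X in measurable X]setTI; exact: measurable_fx.
have -> : [set y | (\bigcup_n F n) (f (x, y))] =
    \bigcup_n [set y | F n (f (x, y))] by [].
apply: measure_semi_sigma_additive.
- by move=> n; exact: mpre.
- apply/trivIsetP => /= i j _ _ ij; apply/seteqP; split => // y /= [Fi Fj].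
  move/trivIsetP : tF => /(_ _ _ I I ij) Fij.
  by have : (F i `&` F j) (f (x, y)) by []; rewrite Fij.
- by apply: (mpre (\bigcup_n F n)).
Qed.

HB.instance Definition _ x := isMeasure.Build _ _ _ (kimage_subdef x)
  (kimage0 x) (kimage_ge0 x) (@kimage_sigma_additive x).

Definition kimage : T1 -> {measure set T3 -> \bar R} := kimage_subdef.

Let measurable_kimage U : measurable U ->
  measurable_fun [set: T1] (kimage ^~ U).
Proof.
move=> mU.
have mA : measurable [set z | U (f z)].
  by rewrite -[X in measurable X]setTI; exact: (measurable_funPT f).
rewrite [X in measurable_fun _ X](_ : _ =
    fun x => k x (xsection [set z | U (f z)] x)).
  by apply: measurable_fun_xsection_finite_kernel; rewrite inE.
by apply/funext => x; rewrite xsectionE.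
Qed.

HB.instance Definition _ := isKernel.Build _ _ _ _ _ kimage measurable_kimage.

Let kimage_prob x : kimage x [set: T3] = 1.
Proof. exact: (prob_kernel (s := k)). Qed.

HB.instance Definition _ := Kernel_isProbability.Build _ _ _ _ _ kimage
  kimage_prob.

End kimage.

Section pbind.
Variables (mu : probability T1 R) (k : R.-pker T1 ~> T2).

Definition pbind_subdef (A : set T2) : \bar R := \int[mu]_x k x A.

Let pbind0 : pbind_subdef set0 = 0.
Proof. by rewrite /pbind_subdef integral0_eq. Qed.

Let pbind_ge0 A : 0 <= pbind_subdef A.
Proof. exact: integral_ge0. Qed.

Let pbind_sigma_additive : semi_sigma_additive pbind_subdef.
Proof.
move=> U mU tU mUU; rewrite [X in _ --> X](_ : _ =
  \int[mu]_x (\sum_(n <oo) k x (U n))); last first.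
  apply: eq_integral => V _.
  by apply/esym/cvg_lim => //; exact/measure_semi_sigma_additive.
apply/cvg_closeP; split.
  by apply: is_cvg_nneseries => n _ _; exact: integral_ge0.
rewrite closeE// integral_nneseries// => n.
exact: measurable_kernel.
Qed.

HB.instance Definition _ := isMeasure.Build _ _ _ pbind_subdef
  pbind0 pbind_ge0 pbind_sigma_additive.

Let pbind_setT : pbind_subdef [set: T2] = 1.
Proof.
rewrite /pbind_subdef; under eq_integral do rewrite prob_kernel.
by rewrite integral_cst// mul1e; exact: probability_setT.
Qed.

HB.instance Definition _ := Measure_isProbability.Build _ _ _ pbind_subdef
  pbind_setT.

Definition pbind : probability T2 R := pbind_subdef.

End pbind.

End kernel_operations.

(* [seq T] as the disjoint union of the powers [n.-tuple T]. *)
Definition measure_seq_display : measure_display -> measure_display.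
Proof. exact. Qed.

Section measurable_seq.
Context d (T : measurableType d).

Definition seq_measurable : set (set (seq T)) :=
  [set A : set (seq T) | forall n, measurable [set t : n.-tuple T | A t]].

Let seq_measurable0 : seq_measurable set0.
Proof. by move=> n; exact: measurable0. Qed.

Let seq_measurableC A : seq_measurable A -> seq_measurable (~` A).
Proof. by move=> mA n; exact: measurableC (mA n). Qed.

Let seq_measurable_bigcup (F : (set (seq T))^nat) :
  (forall i, seq_measurable (F i)) -> seq_measurable (\bigcup_i F i).
Proof.
move=> mF n.
have -> : [set t : n.-tuple T | (\bigcup_i F i) t] =
    \bigcup_i [set t : n.-tuple T | F i t] by [].
by apply: bigcupT_measurable => i; exact: mF.
Qed.

HB.instance Definition _ := isPointed.Build (seq T) [::].

HB.instance Definition _ := @isMeasurable.Build (measure_seq_display d) (seq T)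
  seq_measurable seq_measurable0 seq_measurableC seq_measurable_bigcup.

Lemma measurable_seqP (A : set (seq T)) :
  measurable A <-> forall n, measurable [set t : n.-tuple T | A t].
Proof. by []. Qed.

Lemma measurable_tval n : measurable_fun [set: n.-tuple T] (@tval n T).
Proof. by move=> _ A mA; rewrite setTI; exact: mA. Qed.

Lemma measurable_fun_seqP d' (U : measurableType d') (f : seq T -> U) :
  measurable_fun [set: seq T] f <->
  forall n, measurable_fun [set: n.-tuple T] (fun t => f t).
Proof.
split=> [mf n|mf _ A mA].
  exact: measurableT_comp mf (@measurable_tval n).
rewrite setTI; apply/measurable_seqP => n.
by have := mf n measurableT A mA; rewrite setTI.
Qed.

Lemma measurable_size n : measurable [set h : seq T | size h = n].
Proof.
apply/measurable_seqP => m; have [->|nm] := eqVneq m n.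
  rewrite [X in measurable X](_ : _ = setT)//.
  by apply/seteqP; split => // t _ /=; rewrite size_tuple.
rewrite [X in measurable X](_ : _ = set0)//.
apply/seteqP; split => // t /=; rewrite size_tuple => mn.
by rewrite mn eqxx in nm.
Qed.

Lemma measurable_nth (x0 : T) i : measurable_fun [set: seq T] (nth x0 ^~ i).
Proof.
apply/measurable_fun_seqP => n.
have [ni|ilt] := leqP n i.
  rewrite [X in measurable_fun _ X](_ : _ = cst x0)//.
  by apply/funext => t; rewrite nth_default// size_tuple.
rewrite [X in measurable_fun _ X](_ : _ = (@tnth n T ^~ (Ordinal ilt))).
  exact: measurable_tnth.
by apply/funext => t; rewrite (tnth_nth x0).
Qed.

Lemma measurable_last (x0 : T) : measurable_fun [set: seq T] (last x0).
Proof.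
apply/measurable_fun_seqP => n.
rewrite [X in measurable_fun _ X](_ : _ =
    (nth x0 ^~ n.-1) \o (@tval n T)).
  exact: measurableT_comp (measurable_nth _ _) (@measurable_tval n).
by apply/funext => t /=; rewrite -nth_last size_tuple.
Qed.

Let measurable_rcons_tuple n : measurable_fun [set: n.-tuple T * T]
  (fun z => [tuple of rcons z.1 z.2]).
Proof.
apply/measurable_fun_tnthP => i.
have [ilt|nle] := ltnP i n.
  rewrite [X in measurable_fun _ X](_ : _ =
      (@tnth n T ^~ (Ordinal ilt)) \o fst).
    by apply: measurableT_comp => //; exact: measurable_tnth.
  apply/funext => z /=.
  by rewrite !(tnth_nth point) /= nth_rcons size_tuple ilt.
rewrite [X in measurable_fun _ X](_ : _ = snd)//.
apply/funext => z /=; rewrite (tnth_nth point) /= nth_rcons size_tuple ltnNge.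
have -> : i = n :> nat.
  by apply/eqP; rewrite eqn_leq nle andbT; have := ltn_ord i; rewrite ltnS.
by rewrite leqnn /= eqxx.
Qed.

Definition rcons_pair (z : seq T * T) : seq T := rcons z.1 z.2.

Lemma measurable_rcons : measurable_fun [set: seq T * T] rcons_pair.
Proof.
move=> _ A mA; rewrite setTI.
pose pad n (h : seq T) : n.-tuple T := [tuple nth point h i | i < n].
have mpad n : measurable_fun [set: seq T] (pad n).
  apply/measurable_fun_tnthP => i.
  rewrite [X in measurable_fun _ X](_ : _ = nth point ^~ i).
    exact: measurable_nth.
  by apply/funext => h /=; rewrite tnth_mktuple.
have padK n h : size h = n -> tval (pad n h) = h.
  move=> hn; apply: (@eq_from_nth _ point); rewrite size_tuple// => i ilt.
  by rewrite -[i]/(val (Ordinal ilt)) -tnth_nth tnth_mktuple.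
rewrite [X in measurable X](_ : _ = \bigcup_n
    ([set h | size h = n] `*` setT `&`
     (fun z : seq T * T => [tuple of rcons (pad n z.1) z.2]) @^-1`
       [set t : n.+1.-tuple T | A t])).
  apply: bigcupT_measurable => n; apply: measurableI.
    by apply: measurableX => //; exact: measurable_size.
  rewrite -[X in measurable X]setTI.
  have mpad2 : measurable_fun [set: seq T * T] (fun z => (pad n z.1, z.2)).
    by apply: measurable_fun_pair => //; exact: measurableT_comp (mpad n) _.
  have := measurableT_comp (@measurable_rcons_tuple n) mpad2.
  by move=> /(_ measurableT [set t : n.+1.-tuple T | A t]); apply; exact: mA.
apply/seteqP; split=> [[h y] /= Ahy|[h y] [n _] /= [[hn _]]].
  by exists (size h) => //; split => //=; rewrite padK.
by rewrite padK.
Qed.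

HB.instance Definition _ (x0 : T) :=
  isMeasurableFun.Build _ _ _ _ (last x0) (measurable_last x0).

HB.instance Definition _ :=
  isMeasurableFun.Build _ _ _ _ rcons_pair measurable_rcons.

End measurable_seq.

(* Law of [h0] extended, for each element [x] of [s] in turn, by an entry drawn
   from [K x h], where [h] is the whole history so far. *)
Definition history (R : realType) (X : Type) d (T : measurableType d)
    (K : X -> R.-pker (seq T) ~> T) (h0 : seq T) (s : seq X) :
    probability (seq T) R :=
  foldl (fun mu x => pbind mu (kimage (K x) (@rcons_pair d T))) (\d_h0) s.

Definition neighbors (X : Type) (s s' : seq X) : Prop :=
  exists s1 x x' s2, s = s1 ++ x :: s2 /\ s' = s1 ++ x' :: s2.

(* The data universe carries no sigma-algebra: streams are fixed inputs, so
   measurability is only required in the internal state. *)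
Record streaming_alg (R : realType) (X : Type) dI (I : measurableType dI)
    dO (O : measurableType dO) := StreamingAlg {
  alg_init : I ;
  alg_update : X -> R.-pker I ~> I ;
  alg_output : R.-pker I ~> O }.

Section streaming.
Context (R : realType) (X : Type) dI (I : measurableType dI)
  dO (O : measurableType dO) (A : streaming_alg R X I O).

Let i0 := alg_init A.

(* Law of the list of internal states at times 0, 1, ..., [size s]. *)
Definition state_law (s : seq X) : probability (seq I) R :=
  history (fun x => kprecomp (alg_update A x) (last i0)) [:: i0] s.

Definition output_law (s : seq X) : probability O R :=
  pbind (state_law s) (kprecomp (alg_output A) (last i0)).

Definition intrusion_view c (t : c.-tuple nat) (z : seq I * O) :
    c.-tuple I * O := ([tuple of map (nth i0 z.1) t], z.2).

Let measurable_intrusion_view c (t : c.-tuple nat) :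
  measurable_fun [set: seq I * O] (intrusion_view t).
Proof.
apply: measurable_fun_pair => //; apply/measurable_fun_tnthP => k.
rewrite [X in measurable_fun _ X](_ : _ = (nth i0 ^~ (tnth t k)) \o fst).
  by apply: measurableT_comp => //; exact: measurable_nth.
by apply/funext => z /=; rewrite tnth_map.
Qed.

HB.instance Definition _ c (t : c.-tuple nat) :=
  isMeasurableFun.Build _ _ _ _ (intrusion_view t)
    (measurable_intrusion_view t).

(* Joint law, in one run on [s], of the internal states at the times [t] and of
   the output. *)
Definition intrusion_law c (t : c.-tuple nat) (s : seq X) :
    probability (c.-tuple I * O)%type R :=
  pbind (state_law s)
    (kimage (kprecomp (alg_output A) (last i0)) (intrusion_view t)).

Definition pan_private (c : nat) (eps : R) : Prop :=
  forall s s', neighbors s s' ->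
  forall t : c.-tuple nat, all (fun k => k <= size s)%N t ->
  forall E : set (c.-tuple I * O), measurable E ->
    intrusion_law t s E <= (expR eps)%:E * intrusion_law t s' E.

End streaming.

Definition randomizer (R : realType) (X : Type) d (Y : measurableType d) : Type :=
  X -> pprobability Y R.

Definition randomizer_display : measure_display.
Proof. by constructor. Qed.

(* The coarsest sigma-algebra making every evaluation [r |-> r x] measurable. *)
Section measurable_randomizer.
Context (R : realType) (X : Type) d (Y : measurableType d).
Local Notation rdz := (randomizer R X Y).

HB.instance Definition _ := gen_eqMixin rdz.
HB.instance Definition _ := gen_choiceMixin rdz.
HB.instance Definition _ := isPointed.Build rdz (fun=> point).

Definition randomizer_measurable : set (set rdz) :=
  <<s \bigcup_x preimage_set_system [set: rdz] (fun r => r x) measurable >>.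

HB.instance Definition _ :=
  @isMeasurable.Build randomizer_display rdz randomizer_measurable
    (@sigma_algebra0 _ _ _) (@sigma_algebraC _ _) (@sigma_algebra_bigcup _ _ _).

Lemma measurable_randomizer_eval x :
  measurable_fun [set: rdz] (fun r : rdz => r x).
Proof.
move=> _ B mB; apply: sub_sigma_algebra; exists x => //; by exists B.
Qed.

End measurable_randomizer.

Notation transcript R X Y := (seq (randomizer R X Y * Y)%type).

(* A sequentially interactive protocol: the t-th element is queried exactly
   once, at time t, with the randomizer computed from the transcript of the
   earlier times. *)
Definition protocol (R : realType) (X : Type) d (Y : measurableType d) :=
  {mfun transcript R X Y >-> randomizer R X Y}.

Section local_model.
Context (R : realType) (X : Type) d (Y : measurableType d)
  (P : protocol R X Y).

Let measurable_assigned x :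
  measurable_fun [set: transcript R X Y] (fun h => P h x).
Proof.
exact: measurableT_comp (measurable_randomizer_eval x) (measurable_funPT P).
Qed.

Definition label_response (z : transcript R X Y * Y) : randomizer R X Y * Y :=
  (P z.1, z.2).

Let measurable_label_response :
  measurable_fun [set: transcript R X Y * Y] label_response.
Proof.
apply: measurable_fun_pair => //.
exact: measurableT_comp (measurable_funPT P) measurable_fst.
Qed.

HB.instance Definition _ := isMeasurableFun.Build _ _ _ _ label_response
  measurable_label_response.

Definition transcript_law (s : seq X) : probability (transcript R X Y) R :=
  history (fun x => kimage (kprobability (measurable_assigned x))
    label_response) [::] s.

Definition locally_private (eps : R) : Prop :=
  forall s s', neighbors s s' ->
  forall E : set (transcript R X Y), measurable E ->
    transcript_law s E <= (expR eps)%:E * transcript_law s' E.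

End local_model.

(* Main.v *)
(* Local to pan-private: let the internal state be the transcript so far.  All
   the internal states of a run are prefixes of the final transcript, so the
   view of any number of intrusions is a function of the transcript.

   Pan-private to local: the randomizer of each step reads the current state [i]
   off the last response, draws the next state [j] from the update of [i] by the
   user's element, and responds with [j] and an output drawn from [j].  When two
   streams differ only at time [t], intrusions at [t - 1] and [t] compare the
   joint laws of the two states around time [t].  As the earlier transcript
   influences the state at [t] only through the state at [t - 1], the comparison
   lifts to the joint law of (transcript before [t], state at [t]); it is first
   obtained on measurable rectangles, and then everywhere because a finite
   measure is determined by countable covers by rectangles.  The rest of the
   transcript is a post-processing of that pair. *)

Require Import Defs.
From HB Require Import structures.
From mathcomp Require Import all_boot all_order all_algebra.
From mathcomp Require Import all_classical all_reals all_analysis.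
From mathcomp Require Import measurable_realfun.

Set Implicit Arguments.
Unset Strict Implicit.
Unset Printing Implicit Defensive.

Import Order.TTheory GRing.Theory Num.Theory.

Local Open Scope classical_set_scope.
Local Open Scope ring_scope.

Local Open Scope ereal_scope.

Definition mfun_of d1 d2 (T1 : measurableType d1) (T2 : measurableType d2)
    (f : T1 -> T2) (mf : measurable_fun [set: T1] f) : {mfun T1 >-> T2} :=
  HB.pack f (isMeasurableFun.Build _ _ _ _ f mf).

(** * Mixtures of kernels: integration and post-processing *)

Section pbind_theory.
Context d1 d2 (T1 : measurableType d1) (T2 : measurableType d2) (R : realType).
Implicit Types (mu nu : probability T1 R) (k : R.-pker T1 ~> T2).

(** [pbind mu k] is [k] composed after the kernel on [unit] constantly equal to [mu], so the formula
    for composed kernels applies. *)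
Lemma integral_pbind mu k (f : T2 -> \bar R) :
  (forall y, 0 <= f y) -> measurable_fun [set: T2] f ->
  \int[pbind mu k]_y f y = \int[mu]_x \int[k x]_y f y.
Proof.
move=> f0 mf.
pose l := kprobability (measurable_cst (mu : pprobability T1 R))
  : R.-pker unit ~> T1.
pose k' := kprecomp k (mfun_of (@measurable_snd _ _ unit T1)).
rewrite -[RHS](@integral_kcomp _ _ _ unit T1 T2 R l k' tt f f0 mf).
exact: eq_measure_integral.
Qed.

(** Closure under post-processing: domination by the measure [c * nu] passes to integrals of
    nonnegative functions, here [k ^~ A]. *)
Lemma le_pbindl mu nu k (c : R) : (0 <= c)%R ->
  (forall A, measurable A -> mu A <= c%:E * nu A) ->
  forall A, measurable A -> pbind mu k A <= c%:E * pbind nu k A.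
Proof.
move=> c0 munu A mA; have mk : measurable_fun [set: T1] (k ^~ A).
  exact: measurable_kernel.
have := @ge0_le_measure_integral _ _ _ mu (mscale (NngNum c0) nu) _
  (k ^~ A) _ measurableT _ mk.
rewrite (ge0_integral_mscale _ measurableT _ mk)//; exact.
Qed.

End pbind_theory.

(** * Iterated kernels and histories *)

Section foldl_pbind.
Context (R : realType) (X : Type).

Lemma le_foldl_pbind d (T : measurableType d) (k : X -> R.-pker T ~> T)
    (c : R) (mu nu : probability T R) s : (0 <= c)%R ->
  (forall A, measurable A -> mu A <= c%:E * nu A) ->
  forall A, measurable A ->
    foldl (fun mu x => pbind mu (k x)) mu s A <=
    c%:E * foldl (fun mu x => pbind mu (k x)) nu s A.
Proof.
move=> c0; elim: s mu nu => [//|x s ih] mu nu munu A mA /=.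
by apply: ih => //; exact: le_pbindl.
Qed.

(** Since [phi] intertwines the kernels, a change of variables at each step shows that the second
    chain is the image of the first. This is how state sequences, single states and transcripts are
    compared below. *)
Lemma foldl_pbind_preimage d d' (T : measurableType d) (T' : measurableType d')
    (k : X -> R.-pker T ~> T) (k' : X -> R.-pker T' ~> T')
    (phi : T -> T') (mu : probability T R) (mu' : probability T' R) s :
  measurable_fun [set: T] phi ->
  (forall x z A, measurable A -> k' x (phi z) A = k x z (phi @^-1` A)) ->
  (forall A, measurable A -> mu' A = mu (phi @^-1` A)) ->
  forall A, measurable A ->
    foldl (fun mu x => pbind mu (k' x)) mu' s A =
    foldl (fun mu x => pbind mu (k x)) mu s (phi @^-1` A).
Proof.
move=> mphi kk'; elim: s mu mu' => [//|x s ih] mu mu' mumu' A mA /=.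
apply: ih => // B mB; rewrite /pbind /= /pbind_subdef.
rewrite (@eq_measure_integral _ _ _ _ (pushforward mu phi)); last first.
  by move=> C mC _; exact: mumu'.
rewrite ge0_integral_pushforward//; last exact: measurable_kernel.
by apply: eq_integral => z _ /=; rewrite kk'.
Qed.

End foldl_pbind.

Lemma history_cat (R : realType) X d (T : measurableType d)
    (K : X -> R.-pker (seq T) ~> T) h0 s1 s2 :
  history K h0 (s1 ++ s2) =
  foldl (fun mu x => pbind mu (kimage (K x) (@rcons_pair d T)))
    (history K h0 s1) s2.
Proof. exact: foldl_cat. Qed.

Lemma history_rcons (R : realType) X d (T : measurableType d)
    (K : X -> R.-pker (seq T) ~> T) h0 s x :
  history K h0 (rcons s x) =
  pbind (history K h0 s) (kimage (K x) (@rcons_pair d T)).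
Proof. by rewrite -cats1 history_cat. Qed.

(** A history is a law on sequences of all lengths; discarding this null set allows the entry at the
    current time to be identified with the last one. *)
Lemma history_size (R : realType) X d (T : measurableType d)
    (K : X -> R.-pker (seq T) ~> T) h0 s :
  history K h0 s [set h | size h <> (size s + size h0)%N] = 0.
Proof.
elim/last_ind: s => [|s x ih].
  by rewrite /history /= diracE memNset//=.
rewrite history_rcons /pbind /= /pbind_subdef /kimage /= /kimage_subdef /=.
have mS : measurable [set h : seq T | size h <> (size s + size h0)%N].
  by apply: measurableC; exact: measurable_size.
(* One more entry keeps a right length right and a wrong one wrong, so the integrand is the
   indicator of the previous null set. *)
transitivity (\int[history K h0 s]_h
    (\1_[set h | size h <> (size s + size h0)%N] h)%:E); last first.
  by rewrite integral_indic// setIT.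
apply: eq_integral => h _; rewrite indicE.
have [hs|hs] := pselect (size h = (size s + size h0)%N).
  rewrite memNset/=; last by rewrite hs.
  rewrite (_ : [set _ | _] = set0) ?measure0//; apply/seteqP; split => // y /=.
  by rewrite /rcons_pair /= !size_rcons hs.
rewrite mem_set//= (_ : [set _ | _] = setT) ?prob_kernel//.
apply/seteqP; split => // y _ /=.
by rewrite /rcons_pair !size_rcons addSn => -[].
Qed.

(** * From rectangles to all measurable sets of a product *)

(* A copy of [T1 * T2] whose measurable sets are the rectangles. *)
Definition rectangle d1 d2 (T1 : measurableType d1) (T2 : measurableType d2) :=
  (T1 * T2)%type.

Section rectangle.
Context d1 d2 (T1 : measurableType d1) (T2 : measurableType d2) (R : realType).
Local Notation T := (rectangle T1 T2).

HB.instance Definition _ := Pointed.on T.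

Definition rectangle_measurable : set (set T) :=
  [set A `*` B | A in @measurable _ T1 & B in @measurable _ T2].

Let rectangle0 : rectangle_measurable set0.
Proof. by exists set0 => //; exists set0 => //; rewrite setX0. Qed.

Let rectangleI : setI_closed rectangle_measurable.
Proof.
move=> _ _ [A mA [B mB <-]] [A' mA' [B' mB' <-]].
exists (A `&` A'); first exact: measurableI.
by exists (B `&` B'); [exact: measurableI|rewrite setXI].
Qed.

Let rectangleD : semi_setD_closed rectangle_measurable.
Proof.
move=> _ _ [A mA [B mB <-]] [A' mA' [B' mB' <-]].
exists [set (A `\` A') `*` B; (A `&` A') `*` (B `\` B')]; split.
- exact: finite_set2.
- move=> _ [|] ->.
    by exists (A `\` A'); [exact: measurableD|exists B].
  exists (A `&` A'); first exact: measurableI.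
  by exists (B `\` B') => //; exact: measurableD.
- rewrite bigcup_setU !bigcup_set1; apply/seteqP; split.
    move=> [a b] /= [[Aa Bb] /not_andP]; have [A'a|A'a] := pselect (A' a).
      by case=> // B'b; right.
    by left.
  by move=> [a b] /= [[[Aa A'a] Bb]|[[Aa A'a] [Bb B'b]]]; split=> // -[].
- by move=> _ _ [|] -> [|] -> // [[a b] /= []] [[]] ? ? ? [[]].
Qed.

HB.instance Definition _ :=
  isSemiRingOfSets.Build (measure_prod_display (d1, d2)) T
    rectangle0 rectangleI rectangleD.

Let sub_rectangle : @measurable _ T `<=` @measurable _ (T1 * T2)%type.
Proof. by move=> _ [A mA [B mB <-]]; exact: measurableX. Qed.

Variable nu : {measure set (T1 * T2) -> \bar R}.

(** [nu] is made a measure twice, on the semiring of rectangles and on the sigma-algebra they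
    generate: the first is what gets extended, the second is the candidate extension. *)
Let nu_rect : set T -> \bar R := nu.

Let nu_rect0 : nu_rect set0 = 0. Proof. exact: measure0. Qed.

Let nu_rect_ge0 A : 0 <= nu_rect A. Proof. exact: measure_ge0. Qed.

Let nu_rect_sigma_additive : semi_sigma_additive nu_rect.
Proof.
move=> F mF tF mUF.
have mF' i : measurable (F i : set (T1 * T2)) by exact: sub_rectangle (mF i).
exact: (measure_semi_sigma_additive (s := nu) F mF' tF (sub_rectangle mUF)).

Qed.

HB.instance Definition _ := isMeasure.Build _ _ _ nu_rect
  nu_rect0 nu_rect_ge0 nu_rect_sigma_additive.

Local Notation gT := (g_sigma_algebraType (@measurable _ T)).

Let nu_gen : set gT -> \bar R := nu.

Let nu_gen0 : nu_gen set0 = 0. Proof. exact: measure0. Qed.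

Let nu_gen_ge0 A : 0 <= nu_gen A. Proof. exact: measure_ge0. Qed.

Let gen_rectangle : @measurable _ gT = @measurable _ (T1 * T2)%type.
Proof. by rewrite measurable_prod_measurableType. Qed.

Let nu_gen_sigma_additive : semi_sigma_additive nu_gen.
Proof.
rewrite /semi_sigma_additive gen_rectangle => F mF tF mUF.
exact: (measure_semi_sigma_additive (s := nu) F).
Qed.

HB.instance Definition _ := isMeasure.Build _ _ _ nu_gen
  nu_gen0 nu_gen_ge0 nu_gen_sigma_additive.

(** The right side is the outer measure induced by [nu] on rectangles; by uniqueness of the
    Caratheodory extension it agrees with [nu]. *)
Lemma rectangle_cover_inf D : nu [set: T1 * T2] < +oo -> measurable D ->
  nu D = ereal_inf [set \sum_(k <oo) nu (F k) | F in
    [set F : (set (T1 * T2))^nat |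
    (forall k, rectangle_measurable (F k)) /\ D `<=` \bigcup_k F k]].
Proof.
move=> nuT mD.
rewrite -[LHS](@measure_extension_unique _ T R nu_rect _ nu_gen)
  ?gen_rectangle//.
(* Sigma-finiteness: the whole space is a rectangle of finite measure. *)
exists (fun=> setT); first by rewrite bigcup_const.
move=> _; split => //.
by exists setT => //; exists setT => //; rewrite setXTT.
Qed.

End rectangle.

(** Sets satisfying an inequality need not be closed under complement, so a monotone class argument
    fails. Instead, each cover of [D] by rectangles bounds [nu1 D] by its total [nu2]-mass, and the
    infimum of these masses is [nu2 D]. *)
Lemma le_measure_rectangle d1 d2 (T1 : measurableType d1)
    (T2 : measurableType d2) (R : realType) (nu1 nu2 : {measure set (T1 * T2) -> \bar R}) :
  nu2 [set: T1 * T2] < +oo ->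
  (forall A B, measurable A -> measurable B ->
    nu1 (A `*` B) <= nu2 (A `*` B)) ->
  forall D, measurable D -> nu1 D <= nu2 D.
Proof.
move=> nu2T nu12 D mD; rewrite (rectangle_cover_inf nu2T mD).
apply: le_ereal_inf_tmp => _ [F [mF DF] <-].
have mF' k : measurable (F k).
  by have [A mA [B mB <-]] := mF k; exact: measurableX.
apply: (le_trans (measure_sigma_subadditive nu1 mF' mD DF)).
apply: lee_nneseries => // k _.
by have [A mA [B mB <-]] := mF k; exact: nu12.
Qed.

(** On [N] the difference [f \- g] is positive but has integral at most 0; it vanishes almost
    everywhere on [N], so [N] is null. *)
Lemma integral_le_measure0 d (T : measurableType d) (R : realType)
    (mu : {measure set T -> \bar R}) (N : set T) (f g : T -> \bar R) :
  measurable N -> mu.-integrable N f -> mu.-integrable N g ->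
  (forall x, N x -> g x < f x) ->
  \int[mu]_(x in N) f x <= \int[mu]_(x in N) g x -> mu N = 0.
Proof.
move=> mN fi gi gf ifg.
have fg0 x : N x -> 0 < (f \- g) x by move=> /gf; rewrite /= sube_gt0.
have mfg := measurable_int _ (integrableB mN fi gi).
have : \int[mu]_(x in N) `|(f \- g) x| = 0.
  under eq_integral => x /[!inE] Nx do rewrite gee0_abs ?(ltW (fg0 _ _))//.
  apply/eqP; rewrite eq_le integral_ge0 ?andbT; last first.
    by move=> x /fg0/ltW.
  by rewrite integralB// sube_le0.
move=> /(ae_eq_integral_abs mu mN mfg) [M [mM M0 NM]].
apply: (negligibleP mu mN).1; exists M; split => // x Nx.
apply: NM => /= /(_ Nx); by move=> fg; have := fg0 _ Nx; rewrite /= fg ltxx.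
Qed.

(** * Comparing joint laws of a point and a draw from a kernel *)

Section pgraph.
Context d1 d2 d3 (T1 : measurableType d1) (T2 : measurableType d2)
  (T3 : measurableType d3) (R : realType).
Variables (mu : probability T1 R) (st : {mfun T1 >-> T2}).

(* Joint law of [z] and [y] for [z] drawn from [mu] and [y] from [k (st z)]. *)
Definition pgraph (k : R.-pker T2 ~> T3) : probability (T1 * T3)%type R :=
  pbind mu (kimage (kprecomp k st) (mfun_of (@measurable_id _ _ setT))).

Lemma pgraph_rectangle k A B : measurable A ->
  pgraph k (A `*` B) = \int[mu]_(z in A) k (st z) B.
Proof.
move=> mA; rewrite integral_mkcond; apply: eq_integral => z _.
rewrite /kimage /= /kimage_subdef /kprecomp /= patchE.
case: ifPn => [/[!inE] Az|/negP/[!inE] Az].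
  by rewrite (_ : [set _ | _] = B)//; apply/seteqP; split => // y [].
rewrite (_ : [set _ | _] = set0); first by rewrite (measure0 (k _)).
by apply/seteqP; split => // y [].
Qed.

(* For a fixed [B] the hypothesis gives [k (st z) B <= c * k' (st z) B] for
   almost all [z], hence the conclusion on rectangles. *)
Lemma le_pgraph (k k' : R.-pker T2 ~> T3) (c : R) : (0 <= c)%R ->
  (forall C B, measurable C -> measurable B ->
    \int[mu]_(z in st @^-1` C) k (st z) B <=
    c%:E * \int[mu]_(z in st @^-1` C) k' (st z) B) ->
  forall D, measurable D -> pgraph k D <= c%:E * pgraph k' D.
Proof.
move=> c0 kk'.
apply: (@le_measure_rectangle _ _ _ _ _ (pgraph k)
  (mscale (NngNum c0) (pgraph k'))).
  by rewrite -[X in X < _]/(c%:E * pgraph k' setT) probability_setT mule1 ltry.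
move=> A B mA mB; rewrite -[X in X <= _]/(pgraph k (A `*` B))
  -[leRHS]/(c%:E * pgraph k' (A `*` B)) !pgraph_rectangle//.
have mk (l : R.-pker T2 ~> T3) D : measurable_fun D (fun z => l (st z) B).
  by apply: measurable_funTS; exact: (measurable_kernel (kprecomp l st)).
rewrite -ge0_integralZl//.
apply: ae_ge0_le_integral => //.
- by move=> z _; rewrite mule_ge0.
- exact: measurable_funeM.
(* The bad set is a set of values of [st], so a hypothesis on preimages suffices even for arbitrary
   [A]. Taking [C := N] makes the preimage of [N] null. As [N] depends on [B], only rectangles are
   reached this way. *)
pose N := [set i | c%:E * k' i B < k i B].
have mN : measurable N.
  rewrite -[N]setTI; apply: measurable_lte => //.
    by apply: measurable_funeM; exact: measurable_kernel.
  exact: measurable_kernel.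
have mSN : measurable (st @^-1` N).
  by rewrite -[X in measurable X]setTI; exact: (measurable_funPT st).
exists (st @^-1` N); split => //.
  have int1 (l : R.-pker T2 ~> T3) :
      mu.-integrable (st @^-1` N) (fun z => l (st z) B).
    apply: (le_integrable _ _ _ (finite_measure_integrable_cst mu 1%R mSN)) => //.
    move=> z _; rewrite gee0_abs//= normr1 -(prob_kernel (s := l) (st z)).
    by apply: (le_measure (l (st z))); rewrite ?inE.
  apply: (integral_le_measure0 mSN (int1 k) (integrableZl mSN c (int1 k'))) => //.
  by rewrite ge0_integralZl//; exact: kk'.
by move=> z /= /not_implyP[_ /negP]; rewrite -ltNge.
Qed.

End pgraph.

(** * From local to pan-private: the transcript as internal state *)

Section prefixes.
Context d (T : measurableType d).

(** The state sequence of a run of [history_alg] ending in [w]; the prefix of length 0 is the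
    initial state. *)
Definition prefixes (w : seq T) : seq (seq T) :=
  [seq take i w | i <- iota 0 (size w).+1].

Lemma prefixes_rcons w y :
  prefixes (rcons w y) = rcons (prefixes w) (rcons w y).
Proof.
rewrite /prefixes size_rcons -addn1 iotaD map_cat cats1 add0n.
congr rcons; last by rewrite take_oversize// size_rcons.
apply/eq_in_map => i; rewrite mem_iota add0n ltnS => /andP[_ iw].
by rewrite -cats1 takel_cat.
Qed.

Lemma last_prefixes x0 w : last x0 (prefixes w) = w.
Proof.
by case/lastP: w => [//|w y]; rewrite prefixes_rcons last_rcons.
Qed.

Lemma measurable_take i : measurable_fun [set: seq T] (take i).
Proof.
apply/measurable_fun_seqP => n.
rewrite [X in measurable_fun _ X](_ : _ =
  @tval _ T \o (fun t : n.-tuple T => [tuple of take i t])); last by [].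
apply: measurableT_comp; first exact: measurable_tval.
apply/measurable_fun_tnthP => j.
have jn : (j < n)%N by rewrite (leq_trans (ltn_ord j)) ?geq_minr.
rewrite [X in measurable_fun _ X](_ : _ = @tnth n T ^~ (Ordinal jn)).
  exact: measurable_tnth.
apply/funext => t /=; rewrite !(tnth_nth point)/= nth_take//.
by rewrite (leq_trans (ltn_ord j)) ?geq_minl.
Qed.

Lemma measurable_prefixes : measurable_fun [set: seq T] prefixes.
Proof.
apply/measurable_fun_seqP => n.
rewrite [X in measurable_fun _ X](_ : _ =
  @tval _ (seq T) \o (fun t : n.-tuple T => [tuple take i t | i < n.+1]));
    last first.
  apply/funext => t /=; rewrite /prefixes size_tuple -val_enum_ord -map_comp.
  exact: eq_map.
apply: measurableT_comp; first exact: measurable_tval.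
apply/measurable_fun_tnthP => j.
rewrite [X in measurable_fun _ X](_ : _ = take j \o @tval n T); last first.
  by apply/funext => t /=; rewrite tnth_mktuple.
by apply: measurableT_comp; [exact: measurable_take|exact: measurable_tval].
Qed.

End prefixes.

Lemma pbind_kdirac d1 d2 d3 (T1 : measurableType d1) (T2 : measurableType d2)
    (T3 : measurableType d3) (R : realType) (mu : probability T1 R)
    (g : {mfun T1 >-> T2}) (f : {mfun (T1 * T2)%type >-> T3}) A : measurable A ->
  pbind mu (kimage (kprecomp (kdirac (@measurable_id _ T2 setT)) g) f) A =
  mu [set z | A (f (z, g z))].
Proof.
move=> mA.
have mB : measurable [set z | A (f (z, g z))].
  rewrite -[X in measurable X]setTI.
  suff: measurable_fun setT (fun z => f (z, g z)) by exact.
  apply: measurableT_comp => //; exact: measurable_fun_pair.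
transitivity (\int[mu]_z (\1_[set z | A (f (z, g z))] z)%:E); last first.
  by rewrite integral_indic// setIT.
apply: eq_integral => z _.
by rewrite /kimage /= /kimage_subdef /kprecomp /= diracE indicE.
Qed.

Section history_alg.
Context (R : realType) (X : Type) d (T : measurableType d).
Variable K : X -> R.-pker (seq T) ~> T.

Definition history_alg : streaming_alg R X (seq T) (seq T) :=
  StreamingAlg [::] (fun x => kimage (K x) (@rcons_pair d T))
    (kdirac (@measurable_id _ (seq T) setT)).

(** Appending an entry to a transcript appends the longer transcript to its list of prefixes, so
    [prefixes] intertwines the two chains. *)
Lemma state_law_history_alg s U : measurable U ->
  state_law history_alg s U = history K [::] s (@prefixes _ T @^-1` U).
Proof.
move=> mU; apply: (foldl_pbind_preimage _ (@measurable_prefixes _ T)) => //.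
move=> x w A mA.
rewrite -[LHS]/(K x (last [::] (prefixes w))
  [set y | A (rcons (prefixes w) (rcons (last [::] (prefixes w)) y))]).
rewrite -[RHS]/(K x w [set y | A (prefixes (rcons w y))]) last_prefixes.
by congr (K x w _); apply/funext => y /=; rewrite prefixes_rcons.
Qed.

Lemma output_law_history_alg s B : measurable B ->
  output_law history_alg s B = history K [::] s B.
Proof.
move=> mB; rewrite /output_law.
transitivity (state_law history_alg s (last [::] @^-1` B)); last first.
  rewrite state_law_history_alg; last first.
    by rewrite -[X in measurable X]setTI; exact: measurable_last.
  by congr (history K _ _ _); apply/funext => w;
    rewrite -[LHS]/(B (last [::] (prefixes w))) last_prefixes.
apply: etrans (@pbind_kdirac _ _ _ _ _ _ _ (state_law history_alg s) (last [::])
  (mfun_of (@measurable_snd _ _ (seq (seq T)) (seq T))) B mB).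
by apply: eq_integral.
Qed.

Lemma pan_private_history_alg c (eps : R) :
  (forall s s', neighbors s s' -> forall E, measurable E ->
    history K [::] s E <= (expR eps)%:E * history K [::] s' E) ->
  pan_private history_alg c eps.
Proof.
move=> dpK s s' ss' t _ E mE.
(* The output is the last state, so [E] becomes an event about the state sequence alone. *)
pose V := [set w | E (intrusion_view history_alg t (w, last [::] w))].
have mV : measurable V.
  rewrite -[X in measurable X]setTI.
  suff: measurable_fun setT
      (fun w => intrusion_view history_alg t (w, last [::] w)) by exact.
  apply: measurableT_comp => //; apply: measurable_fun_pair => //.
have lawE r : intrusion_law history_alg t r E =
    history K [::] r (@prefixes _ T @^-1` V).
  rewrite -state_law_history_alg//.
  apply: etrans (@pbind_kdirac _ _ _ _ _ _ _ (state_law history_alg r) (last [::])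
    (intrusion_view history_alg t) E mE).
  by apply: eq_integral.
rewrite !lawE; apply: dpK => //.
by rewrite -[X in measurable X]setTI; exact: measurable_prefixes.
Qed.

End history_alg.

(** * Changes of variables and measurability of randomizers *)

Lemma integral_kimage d1 d2 d3 (T1 : measurableType d1) (T2 : measurableType d2)
    (T3 : measurableType d3) (R : realType) (k : R.-pker T1 ~> T2)
    (f : {mfun (T1 * T2)%type >-> T3}) x (g : T3 -> \bar R) :
  (forall z, 0 <= g z) -> measurable_fun [set: T3] g ->
  \int[kimage k f x]_z g z = \int[k x]_y g (f (x, y)).
Proof.
move=> g0 mg; have mfx : measurable_fun [set: T2] (fun y => f (x, y)).
  exact: measurableT_comp.
rewrite (@eq_measure_integral _ _ _ _ (pushforward (k x) (fun y => f (x, y))))//.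
by rewrite ge0_integral_pushforward.
Qed.

Lemma integral_preimage_law d1 d2 (T1 : measurableType d1)
    (T2 : measurableType d2) (R : realType) (mu : {measure set T1 -> \bar R})
    (nu : {measure set T2 -> \bar R}) (phi : T1 -> T2) :
  measurable_fun [set: T1] phi ->
  (forall B, measurable B -> nu B = mu (phi @^-1` B)) ->
  forall C (f : T2 -> \bar R), measurable C -> measurable_fun C f ->
  (forall y, 0 <= f y) ->
  \int[nu]_(y in C) f y = \int[mu]_(x in phi @^-1` C) f (phi x).
Proof.
move=> mphi numu C f mC mf f0.
rewrite (@eq_measure_integral _ _ _ _ (pushforward mu phi)).
  by rewrite ge0_integral_pushforward.
by move=> A mA _; exact: numu.
Qed.

Section kprob.
Context d1 d2 (T1 : measurableType d1) (T2 : measurableType d2) (R : realType).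
Variable k : R.-pker T1 ~> T2.

(** A name for [k x] that carries a probability structure, as the first argument of [pbind]
    requires. *)
Definition kprob (x : T1) : set T2 -> \bar R := k x.

HB.instance Definition _ x := Measure.on (kprob x).

HB.instance Definition _ x :=
  Measure_isProbability.Build _ _ _ (kprob x) (prob_kernel x).

End kprob.

(** The sigma-algebra on probabilities is generated by the events that the mass of [U] is below
    [r]. *)
Lemma measurable_fun_pprobability d1 d2 (T1 : measurableType d1)
    (T2 : measurableType d2) (R : realType) (f : T1 -> pprobability T2 R) :
  (forall U, measurable U -> measurable_fun [set: T1] (fun z => f z U)) ->
  measurable_fun [set: T1] f.
Proof.
move=> mf.
apply: (measurability (@pset _ _ _ : set (set (pprobability T2 R)))) => //.
move=> _ -[_ [r r01] [U mU <-]] <-; rewrite /mset /preimage/=.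
by apply: emeasurable_fun_infty_o => //; exact: mf.
Qed.

Lemma measurable_fun_randomizer d1 d2 (T : measurableType d1) (R : realType)
    (X : Type) (Y : measurableType d2) (f : T -> randomizer R X Y) :
  (forall x, measurable_fun [set: T] (fun z => f z x)) ->
  measurable_fun [set: T] f.
Proof.
move=> mf; apply: (measurability (\bigcup_x
  preimage_set_system [set: randomizer R X Y] (fun r => r x) measurable)) => //.
move=> _ [_ [x _ [B mB <-]] <-].
by have := mf x measurableT B mB; rewrite !setTI.
Qed.

(** * From pan-private to local: responses carrying the next state *)

Section pan_protocol.
Context (R : realType) (X : Type) dI (I : measurableType dI)
  dO (O : measurableType dO) (A : streaming_alg R X I O).

Let i0 := alg_init A.
Let Y := (I * O)%type.

(** The common marginal of the two models: the law of the last state of a run and of the state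
    carried by the transcript. *)
Definition chain_law (s : seq X) : probability I R :=
  foldl (fun mu x => pbind mu (alg_update A x)) (\d_i0) s.

Definition response x i : pprobability Y R :=
  pbind (kprob (alg_update A x) i)
    (kimage (alg_output A) (mfun_of (@measurable_id _ (I * O)%type setT))).

Let measurable_response x : measurable_fun [set: I] (response x).
Proof.
apply: measurable_fun_pprobability => U mU.
apply: measurable_fun_integral_kernel => //.
  by move=> V mV; exact: measurable_kernel.
exact: measurable_kernel.
Qed.

(** The default makes [i0] the state of the empty transcript, so the first randomizer starts there.
    The output it supplies is an arbitrary point, whence nonempty streams in the output
    comparison. *)
Definition last_entry (h : transcript R X Y) : randomizer R X Y * Y :=
  last (point, (i0, point)) h.

Definition transcript_state (h : transcript R X Y) : I := (last_entry h).2.1.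

Lemma measurable_transcript_state :
  measurable_fun [set: transcript R X Y] transcript_state.
Proof.
by apply: measurableT_comp => //; apply: measurableT_comp.
Qed.

Definition transcript_output (h : transcript R X Y) : O := (last_entry h).2.2.

Lemma measurable_transcript_output :
  measurable_fun [set: transcript R X Y] transcript_output.
Proof.
by apply: measurableT_comp => //; apply: measurableT_comp.
Qed.

Definition pan_randomizer (h : transcript R X Y) : randomizer R X Y :=
  fun x => response x (transcript_state h).

Let measurable_pan_randomizer :
  measurable_fun [set: transcript R X Y] pan_randomizer.
Proof.
apply: measurable_fun_randomizer => x.
exact: measurableT_comp (@measurable_response x) measurable_transcript_state.
Qed.

Definition pan_protocol : protocol R X Y := mfun_of measurable_pan_randomizer.

Lemma chain_law_state s B : measurable B ->
  chain_law s B = state_law A s (last i0 @^-1` B).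
Proof.
move=> mB; apply: (foldl_pbind_preimage _ (measurable_last i0)) => //.
move=> x h C mC.
rewrite -[RHS]/(alg_update A x (last i0 h) [set y | C (last i0 (rcons h y))]).
by congr (alg_update A x _ _); apply/funext => y /=; rewrite last_rcons.
Qed.

Lemma response_rectangle x i B C : measurable B -> measurable C ->
  response x i (B `*` C) = \int[alg_update A x i]_(j in B) alg_output A j C.
Proof.
move=> mB mC; rewrite integral_mkcond; apply: eq_integral => j _.
rewrite /kimage /= /kimage_subdef /= patchE.
case: ifPn => [/[!inE] Bj|/negP/[!inE] Bj].
  by rewrite (_ : [set _ | _] = C)//; apply/seteqP; split => // y [].
rewrite (_ : [set _ | _] = set0); first by rewrite (measure0 (alg_output A j)).
by apply/seteqP; split => // y [].
Qed.

(** The randomizer consults the transcript only through [transcript_state], and the state component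
    of its response follows the update kernel. *)
Lemma chain_law_transcript s B : measurable B ->
  chain_law s B = transcript_law pan_protocol s (transcript_state @^-1` B).
Proof.
move=> mB; apply: (foldl_pbind_preimage _ measurable_transcript_state) => //.
move=> x h C mC.
rewrite -[RHS]/(response x (transcript_state h)
  [set y | C (transcript_state (rcons h (pan_protocol h, y)))]).
rewrite (_ : [set y | _] = C `*` setT); last first.
  apply/seteqP; split=> [y|y []] /=;
    by rewrite /transcript_state /last_entry last_rcons.
rewrite response_rectangle//; under eq_integral do rewrite prob_kernel.
by rewrite integral_cst// mul1e.
Qed.

End pan_protocol.

(** * Output and privacy of the constructed protocol *)

Section pan_protocol_theory.
Context (R : realType) (X : Type) dI (I : measurableType dI)
  dO (O : measurableType dO) (A : streaming_alg R X I O).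

Let i0 := alg_init A.
Let Y := (I * O)%type.

(** Both sides average, over the state before the last element, one update followed by one
    output. *)
Lemma distribution_transcript_output s B : s <> [::] -> measurable B ->
  distribution (transcript_law (pan_protocol A) s)
    (mfun_of (measurable_transcript_output A)) B = output_law A s B.
Proof.
case/lastP: s => [//|s x _ mB].
have mout : measurable_fun [set: I] (alg_output A ^~ B).
  exact: measurable_kernel.
have mint : measurable_fun [set: I]
    (fun i => \int[alg_update A x i]_j alg_output A j B).
  apply: measurable_fun_integral_kernel => // V mV; exact: measurable_kernel.
transitivity (\int[chain_law A s]_i \int[alg_update A x i]_j alg_output A j B).
  rewrite (integral_preimage_law (measurable_transcript_state A)
    (@chain_law_transcript _ _ _ _ _ _ A s))//; last first.
    by move=> i; exact: integral_ge0.
  rewrite /distribution /pushforward /= /transcript_law history_rcons.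
  apply: eq_integral => h _.
  rewrite -[LHS]/(response A x (transcript_state A h)
    [set y | B (transcript_output A (rcons h (pan_protocol A h, y)))]).
  rewrite (_ : [set y | _] = setT `*` B); last first.
    apply/seteqP; split=> [y|y []] /=;
      by rewrite /transcript_output /last_entry last_rcons.
  by rewrite response_rectangle.
rewrite -integral_pbind//.
rewrite (_ : pbind _ _ = chain_law A (rcons s x)); last first.
  by rewrite /chain_law -cats1 foldl_cat.
by rewrite (integral_preimage_law (measurable_last i0)
  (@chain_law_state _ _ _ _ _ _ A (rcons s x))).
Qed.

Let view_rectangle (C B : set I) : set (2.-tuple I * O) :=
  [set z | C (tnth z.1 ord0) /\ B (tnth z.1 ord_max)].

(** Intrusions just before and just after the last element see two consecutive states of the chain.
    This brings pan-privacy to the form of the hypothesis of [le_pgraph]. *)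
Lemma intrusion_law_rcons s x C B : measurable C -> measurable B ->
  intrusion_law A [tuple size s; (size s).+1] (rcons s x) (view_rectangle C B) =
  \int[chain_law A s]_(i in C) alg_update A x i B.
Proof.
move=> mC mB.
pose V := [set h : seq I | C (nth i0 h (size s)) /\ B (nth i0 h (size s).+1)].
have mV : measurable V.
  apply: measurableI; rewrite -[X in measurable X]setTI; exact: measurable_nth.
transitivity (state_law A (rcons s x) V).
  transitivity (\int[state_law A (rcons s x)]_h (\1_V h)%:E); last first.
    by rewrite integral_indic// setIT.
  apply: eq_integral => h _; rewrite indicE.
  rewrite -[LHS]/(alg_output A (last i0 h)
    [set o | view_rectangle C B
      (intrusion_view A [tuple size s; (size s).+1] (h, o))]).
  have [Vh|Vh] := pselect (V h).
    rewrite mem_set// (_ : [set o | _] = setT); first exact: prob_kernel.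
    by apply/seteqP; split.
  rewrite memNset// (_ : [set o | _] = set0);
    first by rewrite (measure0 (alg_output A _)).
  by apply/seteqP; split.
have mup D : measurable_fun D (fun i => alg_update A x i B).
  by apply: measurable_funTS; exact: measurable_kernel.
rewrite (integral_preimage_law (measurable_last i0)
  (@chain_law_state _ _ _ _ _ _ A s))//.
have mlC : measurable (last i0 @^-1` C).
  by rewrite -[X in measurable X]setTI; exact: measurable_last.
rewrite integral_mkcond /state_law history_rcons.
have mlast : measurable_fun [set: seq I]
    ((fun h => alg_update A x (last i0 h) B) \_ (last i0 @^-1` C)).
  apply/(measurable_restrictT _ mlC); apply: measurable_funTS.
  exact: (measurable_kernel (kprecomp (alg_update A x) (last i0))).
apply: ge0_ae_eq_integral => //.
- exact: measurable_kernel.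
- by move=> h _; rewrite patchE; case: ifP.
(* The initial state is entry 0, so entry [size s] is the last one exactly for histories of length
   [size s + 1]; other lengths have probability 0. *)
exists [set h | size h <> (size s + size [:: i0])%N]; split.
- by apply: measurableC; exact: measurable_size.
- exact: history_size.
move=> h /= /not_implyP[_ neq] hs; apply: neq.
rewrite addn1 in hs.
rewrite -[LHS]/(alg_update A x (last i0 h) [set y | V (rcons h y)]) patchE.
rewrite (_ : [set y | V (rcons h y)] = [set y | C (last i0 h) /\ B y]);
    last first.
  apply/funext => y /=; rewrite /V /= !nth_rcons hs ltnSn ltnn eqxx.
  by rewrite -[size s]/(size s).+1.-1 -hs nth_last.
case: ifPn => [/[!inE] Ch|/negP/[!inE] Ch].
  by rewrite (_ : [set _ | _] = B)//; apply/seteqP; split => // y [].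
rewrite (_ : [set _ | _] = set0);
  first by rewrite (measure0 (alg_update A x _)).
by apply/seteqP; split => // y [].
Qed.

Definition append_entry (z : transcript R X Y * I * O) : transcript R X Y :=
  rcons_pair (z.1.1, (pan_protocol A z.1.1, (z.1.2, z.2))).

Let measurable_append_entry :
  measurable_fun [set: transcript R X Y * I * O] append_entry.
Proof.
apply: (measurableT_comp (@measurable_rcons _ (randomizer R X Y * Y)%type)).
have m11 : measurable_fun [set: transcript R X Y * I * O] (fun z => z.1.1).
  exact: measurableT_comp.
apply: measurable_fun_pair => //; apply: measurable_fun_pair.
  exact: measurableT_comp.
by apply: measurable_fun_pair => //; exact: measurableT_comp.
Qed.

(* The transcript after [x] is a post-processing, not depending on [x], of the
   transcript before [x] and the internal state after [x]. *)
Lemma transcript_law_rcons s x E : measurable E ->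
  transcript_law (pan_protocol A) (rcons s x) E =
  pbind (pgraph (transcript_law (pan_protocol A) s)
      (mfun_of (measurable_transcript_state A)) (alg_update A x))
    (kimage (kprecomp (alg_output A) (mfun_of (@measurable_snd _ _ _ I)))
      (mfun_of measurable_append_entry)) E.
Proof.
move=> mE; rewrite [RHS]integral_pbind//; last exact: measurable_kernel.
rewrite [in LHS]/transcript_law history_rcons; apply: eq_integral => h _.
by rewrite integral_kimage//; exact: measurable_kernel.
Qed.

Lemma locally_private_pan_protocol eps :
  pan_private A 2 eps -> locally_private (pan_protocol A) eps.
Proof.
move=> privA s s' [s1 [x [x' [s2 [-> ->]]]]] E mE.
rewrite -!cat_rcons /transcript_law !history_cat.
have eps0 : (0 <= expR eps)%R by exact: expR_ge0.
(* Two post-processings are removed: the common suffix [s2], then the drawing of the output and the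
   appending of the entry. *)
apply: le_foldl_pbind mE => // F mF.
rewrite !transcript_law_rcons//; apply: le_pbindl mF => //.
apply: le_pgraph => // C B mC mB.
have intE u : \int[transcript_law (pan_protocol A) s1]_(h in
      transcript_state A @^-1` C) alg_update A u (transcript_state A h) B =
    intrusion_law A [tuple size s1; (size s1).+1] (rcons s1 u)
      (view_rectangle C B).
  rewrite intrusion_law_rcons//.
  rewrite (integral_preimage_law (measurable_transcript_state A)
    (@chain_law_transcript _ _ _ _ _ _ A s1))//.
  by apply: measurable_funTS; exact: measurable_kernel.
rewrite !intE; apply: privA.
(* Pan-privacy is applied to the streams cut right after the differing element, so the second
   intrusion falls at their end. *)
- by exists s1, x, x', [::]; rewrite !cats1.
- by rewrite /= size_rcons leqnSn leqnn.
- apply: measurableI; rewrite -[X in measurable X]setTI.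
    by apply: (measurableT_comp (measurable_tnth ord0) measurable_fst).
  by apply: (measurableT_comp (measurable_tnth ord_max) measurable_fst).
Qed.
End pan_protocol_theory.

(* The two translations together *)
Local Close Scope ereal_scope.

Theorem theorem1 (R : realType) (X : Type) (eps : R) (eps_gt0 : 0 < eps) :
  (forall (dI : measure_display) (I : measurableType dI)
      (dO : measure_display) (O : measurableType dO)
      (A : streaming_alg R X I O),
    pan_private A 2 eps ->
    exists (dY : measure_display) (Y : measurableType dY)
        (P : protocol R X Y) (readout : {mfun transcript R X Y >-> O}),
      locally_private P eps /\
      forall s : seq X, s <> [::] -> forall B : set O, measurable B ->
        distribution (transcript_law P s) readout B = output_law A s B) /\
  (forall (dY : measure_display) (Y : measurableType dY) (P : protocol R X Y),
    locally_private P eps ->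
    exists (dI : measure_display) (I : measurableType dI)
        (A : streaming_alg R X I (transcript R X Y)),
      pan_private A 2 eps /\
      forall (s : seq X) (B : set (transcript R X Y)), measurable B ->
        output_law A s B = transcript_law P s B).
Proof.
split=> [dI I dO O A privA|dY Y P privP].
  exists _, (I * O)%type, (pan_protocol A),
    (mfun_of (measurable_transcript_output A)); split.
    exact: locally_private_pan_protocol.
  by move=> s s0 B mB; exact: distribution_transcript_output.
(* [transcript_law] is by definition a history; [K] is its kernel, drawing a response and labelling
   it with its randomizer, and is found by unification. *)
have [K lawE] : exists K : X -> R.-pker (transcript R X Y) ~> _,
    forall s, transcript_law P s = history K [::] s by eexists.
exists _, (transcript R X Y), (history_alg K); split.
  apply: pan_private_history_alg => s s' ss' E mE.
  by rewrite -!lawE; exact: privP.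
by move=> s B mB; rewrite lawE; exact: output_law_history_alg.
Qed.
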